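(* If $\mathcal M\subset\mathbb Z^n$ is a minimal subgraph, then there do not exist two parallel hyperplanes in $\mathbb R^n$ bounding $\mathcal M$ (i.e. $\mathcal M$ is not contained in the closed slab between two parallel hyperplanes).
   Context: $\mathbb Z^n$ is the integer lattice graph ($x\sim y$ iff $|x-y|=1$). For $\Omega\subset\mathbb Z^n$: $\tau\Omega=\{z\notin\Omega:\exists w\in\Omega,z\sim w\}$, $\overline\Omega=\Omega\cup\tau\Omega$, $E_\Omega$ = edges $\{x,y\}$ with $x\in\Omega,y\in\overline\Omega$, $\partial K$ = edges with exactly one endpoint in $K$. A proper nonempty $\mathcal M\subset\mathbb Z^n$ is minimal if for every finite $U$ and every $\hat K\subset\overline U$ with $\hat K\cap\tau U=\mathcal M\cap\tau U$, $|\partial\mathcal M\cap E_U|\le|\partial\hat K\cap E_U|$. *)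

(* Defs.v *)
From HB Require Import structures.
From mathcomp Require Import all_boot all_order all_algebra.
From mathcomp Require Import boolp classical_sets functions cardinality reals.

Set Implicit Arguments.
Unset Strict Implicit.
Unset Printing Implicit Defensive.

Import Order.TTheory GRing.Theory Num.Theory.

Local Open Scope ring_scope.
Local Open Scope classical_set_scope.
Local Open Scope card_scope.

Definition dot (R : pzRingType) (n : nat) (u v : 'rV[R]_n) : R :=
  \sum_(i < n) u 0 i * v 0 i.

Section LatticeGraph.
Variable n : nat.
Local Notation Zn := 'rV[int]_n.

(* For the Euclidean norm, |x - y| = 1 iff |x - y|^2 = 1, and the latter is
   an equation in int. *)
Definition adj (x y : Zn) : Prop := dot (x - y) (x - y) = 1.

Definition outer_boundary (Omega : set Zn) : set Zn :=
  [set z | ~ Omega z /\ exists2 w, Omega w & adj z w].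

Definition vclosure (Omega : set Zn) : set Zn :=
  Omega `|` outer_boundary Omega.

(* An edge is the unordered pair of its endpoints, so each edge is counted
   once in the cardinalities below. *)
Definition edges_in (Omega : set Zn) : set (set Zn) :=
  [set e | exists x y,
     [/\ adj x y, Omega x, vclosure Omega y & e = [set x; y]]].

Definition edge_boundary (K : set Zn) : set (set Zn) :=
  [set e | exists x y, [/\ adj x y, K x, ~ K y & e = [set x; y]]].

Definition minimal_subgraph (M : set Zn) : Prop :=
  [/\ M !=set0, M != setT &
      forall U K : set Zn, finite_set U -> K `<=` vclosure U ->
        K `&` outer_boundary U = M `&` outer_boundary U ->
        edge_boundary M `&` edges_in U #<= edge_boundary K `&` edges_in U].

End LatticeGraph.

(* The points on or between the hyperplanes {p | dot v p = a} and
   {p | dot v p = b}; for v != 0 and a < b these are two distinct parallel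
   hyperplanes, and every such pair is of this form. *)
Definition closed_slab (R : realType) (n : nat) (v : 'rV[R]_n) (a b : R) :
    set 'rV[R]_n :=
  [set p | a <= dot v p <= b].

Definition lattice_embed (R : realType) (n : nat) (x : 'rV[int]_n) :
    'rV[R]_n :=
  map_mx intr x.

(* Main.v *)
(* Choose a coordinate direction e_i with v_i <> 0: a line in this direction
   meets the slab in at most w lattice points.  Hence, for a finite U, the set
   M :&: U has at least |M :&: U| / w points from which a step along e_i leaves
   M :&: U, either through an edge of the boundary of M or into a point of M on
   the outer boundary of U.  Deleting M inside U shows, by minimality, that the
   boundary edges number at most a constant times |M :&: tau U|.  So
   |M :&: U| <= C |M :&: tau U|; for boxes U of radius r this makes
   |M :&: box r| grow exponentially in r, whereas it is at most (2r + 1)^n. *)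
Require Import Defs.
From HB Require Import structures.
From mathcomp Require Import all_boot all_order all_algebra finmap zify lra.
From mathcomp Require Import boolp classical_sets functions cardinality reals.

Set Implicit Arguments.
Unset Strict Implicit.
Unset Printing Implicit Defensive.

Import Order.TTheory GRing.Theory Num.Theory.

Local Open Scope ring_scope.
Local Open Scope classical_set_scope.
Local Open Scope card_scope.

(** * Cardinality of finite sets as a natural number *)

(** [fset_set] sends every infinite set to the empty one, so the value is meaningful for finite sets
    only. *)
Definition ncard (T : choiceType) (A : set T) : nat := #|` fset_set A|%fset.

Lemma ncard_le (T U : choiceType) (A : set T) (B : set U) :
  finite_set B -> A #<= B -> (ncard A <= ncard B)%N.
Proof.
move=> /finite_setP[m Bm] AB; rewrite /ncard (card_fset_set Bm).
by apply: geq_card_fset_set; rewrite -(card_le_eqr Bm).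
Qed.

Lemma ncard_sub (T : choiceType) (A B : set T) :
  finite_set B -> A `<=` B -> (ncard A <= ncard B)%N.
Proof. by move=> finB AB; apply: ncard_le => //; apply: subset_card_le. Qed.

Lemma ncard_gt0 (T : choiceType) (A : set T) x :
  finite_set A -> A x -> (0 < ncard A)%N.
Proof.
move=> finA Ax; rewrite cardfs_gt0; apply/fset0Pn; exists x.
by rewrite in_fset_set// inE.
Qed.

Lemma ncardU_disjoint (T : choiceType) (A B : set T) :
  finite_set A -> finite_set B -> A `&` B = set0 ->
  ncard (A `|` B) = (ncard A + ncard B)%N.
Proof.
move=> finA finB AB0; rewrite /ncard fset_setU// cardfsU -fset_setI// AB0.
by rewrite fset_set0 cardfs0 subn0.
Qed.

Lemma ncardU_le (T : choiceType) (A B : set T) :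
  finite_set A -> finite_set B -> (ncard (A `|` B) <= ncard A + ncard B)%N.
Proof. by move=> finA finB; rewrite /ncard fset_setU// cardfsU leq_subr. Qed.

Lemma ncardX_le (T U : choiceType) (A : set T) (B : set U) :
  finite_set A -> finite_set B ->
  (ncard (A `*` B) <= ncard A * ncard B)%N.
Proof.
move=> finA finB; rewrite /ncard.
have finAB := finite_setX finA finB.
rewrite -(size_allpairs (fun x y => (x, y))).
apply: uniq_leq_size (fset_uniq _) _ => -[x y].
rewrite in_fset_set// inE => -[/= Ax By].
by apply/allpairsP; exists (x, y); split; rewrite ?in_fset_set ?inE.
Qed.

(** * Exponentials outgrow polynomials *)

Lemma linear_lt_exp2 (a b : nat) : exists m, (a * m + b < 2 ^ m)%N.
Proof.
pose p := (2 * a + b + 1)%N; exists (p + p)%N; rewrite expnD.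
have lt_p : (p < 2 ^ p)%N by apply: ltn_expl.
apply: (@leq_trans (p.+1 * p.+1)%N); last exact: leq_mul.
rewrite /p; nia.
Qed.

(** With [j.+1 = 2 ^ m] the left side is at most [2 ^ ((d + m) * n)], whose exponent is linear in
    [m]; the [+ 1] in the linear bound pays for [j] being [2 ^ m - 1]. *)
Lemma poly_lt_exp2 (d n : nat) : exists j, ((d * j.+1) ^ n < 2 ^ j)%N.
Proof.
have [m hm] := linear_lt_exp2 n (d * n + 1).
exists (2 ^ m).-1; rewrite prednK ?expn_gt0//.
have ledm : (d * 2 ^ m <= 2 ^ (d + m))%N.
  by rewrite expnD leq_mul2r ltnW ?orbT// ltn_expl.
case: n hm => [|n] hm; first by rewrite expn0 -{1}(expn0 2) ltn_exp2l//; lia.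
apply: leq_ltn_trans (_ : 2 ^ ((d + m) * n.+1) < _)%N.
  by rewrite expnM leq_exp2r.
rewrite ltn_exp2l//; nia.
Qed.

(** Bernoulli's inequality for [(1 + 1/c) ^ k], multiplied by [c ^ k.+1]. *)
Lemma bernoulliS (c k : nat) : (c ^ k * (c + k) <= c.+1 ^ k * c)%N.
Proof.
elim: k => [|k IH]; first by rewrite !expn0 addn0.
rewrite !expnS; nia.
Qed.

(** Bernoulli gives [(1 + 1/c) ^ c >= 2], so for [k = c * j] the ratio of the two powers is at least
    [2 ^ j], which beats a polynomial in [j]. *)
Lemma poly_lt_exp_ratio (c d n : nat) :
  (0 < c)%N -> exists k, (c ^ k * (2 * (d + k)).+1 ^ n < c.+1 ^ k)%N.
Proof.
move=> c_gt0; have [j hj] := poly_lt_exp2 (2 * (d + c) + 1) n.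
exists (c * j)%N; apply: (@leq_ltn_trans (c ^ (c * j) *
  ((2 * (d + c) + 1) * j.+1) ^ n)%N).
  rewrite leq_mul2l; apply/orP; right; case: n {hj} => [//|n].
  by rewrite leq_exp2r//; nia.
have ratio : (2 * c ^ c <= c.+1 ^ c)%N.
  have := bernoulliS c c; rewrite addnn -mul2n mulnA leq_pmul2r//.
  by rewrite mulnC.
apply: (@leq_trans (c ^ (c * j) * 2 ^ j)%N).
  by rewrite ltn_pmul2l ?expn_gt0 ?c_gt0.
case: j {hj} => [|j]; first by rewrite muln0 !expn0.
by rewrite !expnM -expnMn leq_exp2r// mulnC.
Qed.

(* Moving along [e] from any point of [S], one leaves [S] after at most [w]
   steps; so every point of [S] is an exit point shifted back by some [t < w]. *)
Lemma ncard_le_exits (V : zmodType) (S : set V) (e : V) (w : nat) :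
  finite_set S ->
  (forall x, S x -> exists2 t, (t <= w)%N & ~ S (x + e *+ t)) ->
  (ncard S <= w * ncard [set x | S x /\ ~ S (x + e)%R])%N.
Proof.
move=> finS exit; set D := [set x | _].
have finD : finite_set D by apply: sub_finite_set finS => x [].
have finw := finite_II w; have finwD := finite_setX finw finD.
have ncardw : ncard `I_w = w by apply: card_fset_set; exact: card_eqxx.
rewrite -ncardw; apply: leq_trans (ncardX_le finw finD).
apply: ncard_le => //.
apply: card_le_trans (card_image_le (fun p : nat * V => p.2 - e *+ p.1) _).
apply: subset_card_le => x Sx; have [t letw nSt] := exit x Sx.
have ex : exists t, `[< ~ S (x + e *+ t) >] by exists t; apply/asboolP.
(* The least exit time is some [s.+1], so [x + e *+ s] still lies in [S] and is an exit point. *)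
case: (ex_minnP ex) => -[|s] /asboolP nSs mins.
  by rewrite mulr0n addr0 in nSs.
have lesw : (s < w)%N by apply: leq_trans letw; apply: mins; apply/asboolP.
exists (s, x + e *+ s) => /=; last by rewrite addrK.
split => //=; split; last by rewrite -addrA -mulrSr.
by apply: contrapT => /asboolP/mins; rewrite ltnn.
Qed.

(** * Boxes and adjacency in the lattice *)

Section Lattice.
Variable n : nat.
Local Notation Zn := 'rV[int]_n.
Implicit Types (x y u : Zn) (U M K : set Zn).

Definition box (r : nat) : set Zn := [set x | forall i, `|x 0 i| <= r%:Z].

Lemma box_card_le r : box r #<= [set: 'rV['I_(r.*2.+1)]_n].
Proof.
pose f (y : 'rV['I_(r.*2.+1)]_n) : Zn := \row_i ((y 0 i : nat)%:Z - r%:Z).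
apply: card_le_trans (card_image_le f _).
apply: subset_card_le => x bx; exists (\row_i inord (absz (x 0 i + r%:Z))) => //.
apply/rowP => i; rewrite !mxE inordK; have := bx i; lia.
Qed.

Lemma finite_box r : finite_set (box r).
Proof. exact: card_le_finite (box_card_le r) finite_finset. Qed.

Lemma ncard_box r : (ncard (box r) <= r.*2.+1 ^ n)%N.
Proof.
apply: leq_trans (ncard_le finite_finset (box_card_le r)) _.
rewrite /ncard; set A := fset_set _.
rewrite -[X in (_ <= X)%N]/(r.*2.+1 ^ n)%N.
have <- : #|{: 'rV['I_(r.*2.+1)]_n}| = (r.*2.+1 ^ n)%N.
  by rewrite card_mx card_ord mul1n.
by rewrite cardE; apply: uniq_leq_size (fset_uniq _) _ => y _; rewrite mem_enum.
Qed.

Lemma box_add r s x u : box r x -> box s u -> box (r + s) (x + u).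
Proof.
by move=> bx bu i; rewrite mxE PoszD (le_trans (ler_normD _ _))// lerD.
Qed.

Lemma in_some_box x : exists r, box r x.
Proof.
exists (\sum_i absz (x 0%R i))%N => i.
by rewrite -abszE lez_nat (bigD1 i) //= leq_addr.
Qed.

Lemma adjC x y : adj x y -> adj y x.
Proof.
rewrite /adj -opprB /dot => <-; apply: eq_bigr => i _.
by rewrite !mxE mulrNN.
Qed.

(** Each squared coordinate is at most their sum, which is 1. Thus [box 1] contains all
    displacements to neighbours, and its size bounds the degree. *)
Lemma adj_box1 x y : adj x y -> box 1 (y - x).
Proof.
move=> /adjC; rewrite /adj /dot; set u := y - x => uu i.
have norm_le1 (t : int) : t * t <= 1 -> `|t| <= 1%:Z by nia.
apply: norm_le1; rewrite -uu (bigD1 i)//= lerDl; apply: sumr_ge0 => j _.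
by rewrite -expr2 sqr_ge0.
Qed.

Lemma adj_delta x i : adj (x + delta_mx 0 i) x.
Proof.
rewrite /adj addrC addKr /dot (bigD1 i)//= big1 => [|j ji].
  by rewrite !mxE !eqxx mulr1 addr0.
by rewrite !mxE (negPf ji) andbF mulr0.
Qed.

(** * Counting consequences of minimality *)

Lemma finite_outer_boundary U : finite_set U -> finite_set (outer_boundary U).
Proof.
move=> finU; pose f (p : Zn * Zn) := p.1 + p.2.
apply: sub_finite_set (finite_image f (finite_setX finU (finite_box 1))).
move=> z [_ [w Uw zw]]; exists (w, z - w); last by rewrite /f /= addrC subrK.
by split=> //=; apply: adj_box1; apply: adjC.
Qed.

(* Compare [M] with the competitor obtained by deleting all of [M] inside [U]:
   only edges at vertices of [M] on the outer boundary of [U] remain. *)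
Lemma minimal_edge_boundary_le M U :
  minimal_subgraph M -> finite_set U ->
  edge_boundary M `&` edges_in U #<= (M `&` outer_boundary U) `*` box 1.
Proof.
move=> [_ _ minM] finU; set T := M `&` outer_boundary U.
have TU : T `<=` vclosure U by move=> x [_ Ux]; right.
have TT : T `&` outer_boundary U = M `&` outer_boundary U.
  by rewrite /T -setIA setIid.
apply: card_le_trans (minM U T finU TU TT) _.
(* An edge is coded by its endpoint in [T] and the displacement to the other one. *)
pose f (p : Zn * Zn) : set Zn := [set p.1; p.1 + p.2].
apply: card_le_trans (card_image_le f _).
apply: subset_card_le => e [[x [y [xy Tx _ ->]]] _].
exists (x, y - x); last by rewrite /f /= addrC subrK.
by split => //=; apply: adj_box1.
Qed.

(** Each such [x] yields the boundary edge from [x] to [x + delta_mx 0 i], and distinct points yield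
    distinct edges. *)
Lemma minimal_exits_le M U i :
  minimal_subgraph M -> finite_set U ->
  (ncard [set x | (M `&` U) x /\ ~ M (x + delta_mx 0 i)%R] <=
   ncard (M `&` outer_boundary U) * ncard (box 1))%N.
Proof.
move=> minM finU; have finT := finite_outer_boundary finU.
have finMT : finite_set (M `&` outer_boundary U).
  by apply: sub_finite_set finT => x [].
apply: leq_trans (ncardX_le finMT (finite_box 1)).
apply: ncard_le; first exact: finite_setX finMT (finite_box 1).
apply: card_le_trans (minimal_edge_boundary_le minM finU).
pose e : Zn := delta_mx 0 i; set D := [set x | _].
(* This excludes that one edge arises from both of its endpoints. *)
have e2 : e + e != 0.
  by apply/eqP => /rowP/(_ i); rewrite !mxE !eqxx.
pose f x : set Zn := [set x; x + e].
have /card_eqPle[_ Df] : f @` D #= D.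
  apply: inj_card_eq => x y _ _ fxy.
  have fx : f y x by rewrite -fxy; left.
  have fy : f x y by rewrite fxy; left.
  case: fx => // xE; case: fy => // yE.
  by case/eqP: e2; apply: (addrI x); rewrite addrA -yE -xE addr0.
apply: card_le_trans Df _; apply: subset_card_le => _ [x [[Mx Ux] nMx] <-].
split; exists x, (x + e); split => //; try by apply: adjC; apply: adj_delta.
have [Uxe|nUxe] := pselect (U (x + e)); first by left.
by right; split=> //; exists x => //; apply: adj_delta.
Qed.

(** Exit points of [M] inside [U] either leave [M] ([D1], bounded by minimality) or stay in [M] and
    leave [U] ([D2], injected into the outer boundary by translation); the successor in the constant
    accounts for [D2]. *)
Lemma minimal_ncard_le M U i w :
  minimal_subgraph M -> finite_set U ->
  (forall x, M x -> exists2 t, (t <= w)%N & ~ M (x + delta_mx 0 i *+ t)) ->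
  (ncard (M `&` U) <=
   w * (ncard (box 1)).+1 * ncard (M `&` outer_boundary U))%N.
Proof.
move=> minM finU exit; set e := delta_mx 0 i in exit.
have finT := finite_outer_boundary finU.
have finMT : finite_set (M `&` outer_boundary U).
  by apply: sub_finite_set finT => x [].
have finMU : finite_set (M `&` U) by apply: sub_finite_set finU => x [].
apply: leq_trans (ncard_le_exits (e := e) (w := w) finMU _) _.
  move=> x [Mx _]; have [t letw nMt] := exit x Mx.
  by exists t => // -[].
rewrite -mulnA leq_mul2l; apply/orP; right.
set D1 := [set x | (M `&` U) x /\ ~ M (x + e)%R].
pose D2 := [set x | (M `&` U) x /\ (M `&` outer_boundary U) (x + e)%R].
have finD1 : finite_set D1 by apply: sub_finite_set finMU => x [].
have finD2 : finite_set D2 by apply: sub_finite_set finMU => x [].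
have D1_le := minimal_exits_le i minM finU.
have D2_le : (ncard D2 <= ncard (M `&` outer_boundary U))%N.
  apply: ncard_le => //.
  have /card_eqPle[_ D2e] : (fun x : Zn => x + e) @` D2 #= D2.
    by apply: inj_card_eq => x y _ _ /addIr.
  apply: card_le_trans D2e _; apply: subset_card_le.
  by move=> _ [x [_ ?] <-].
have finD12 : finite_set (D1 `|` D2) by rewrite finite_setU.
apply: leq_trans (ncard_sub finD12 _) _.
  move=> x [[Mx Ux] nMUx].
  have [Mxe|nMxe] := pselect (M (x + e)); last by left.
  right; split=> //; split=> //; split; first by move=> Uxe; apply: nMUx.
  by exists x => //; apply: adj_delta.
apply: leq_trans (ncardU_le finD1 finD2) _.
by rewrite mulSn addnC mulnC leq_add// mulnC.
Qed.

(** * Growth of a minimal set over boxes *)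

Lemma outer_boundary_box r : outer_boundary (box r) `<=` box r.+1.
Proof.
move=> z [_ [w bw zw]]; rewrite -(subrK w z) addrC -addn1.
by apply: box_add => //; apply: adj_box1; apply: adjC.
Qed.

Lemma minimal_not_thin M i w :
  minimal_subgraph M ->
  ~ forall x, M x -> exists2 t, (t <= w)%N & ~ M (x + delta_mx 0 i *+ t).
Proof.
move=> minM exit; have [[x0 Mx0] _ _] := minM.
have [r0 br0] := in_some_box x0.
pose V r := ncard (M `&` box r).
have finV r : finite_set (M `&` box r).
  by apply: sub_finite_set (finite_box r) => x [].
have V_gt0 : (0 < V r0)%N by apply: (@ncard_gt0 _ _ x0).
pose C := (w * (ncard (box 1)).+1)%N.
(* If [w] were 0, the exit condition at [x0] would contradict [M x0]. *)
have C_gt0 : (0 < C)%N.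
  rewrite /C muln_gt0 andbT lt0n; apply/eqP => w0.
  have [t] := exit x0 Mx0; rewrite w0 leqn0 => /eqP->.
  by rewrite mulr0n addr0.
(* The next box also contains the points of [M] on the outer boundary, which number at least
   [V r / C]. *)
have stepV r : (C.+1 * V r <= C * V r.+1)%N.
  have le1 := minimal_ncard_le minM (finite_box r) exit.
  set T := M `&` outer_boundary (box r) in le1.
  have TV : M `&` box r `|` T `<=` M `&` box r.+1.
    move=> x [[Mx bx]|[Mx /outer_boundary_box]] //; split=> // j.
    by have := bx j; lia.
  have finT : finite_set T.
    by apply: sub_finite_set (finV r.+1) => x Tx; apply: TV; right.
  have := ncard_sub (finV r.+1) TV; rewrite ncardU_disjoint//; last first.
    by apply/seteqP; split=> // x [[_ bx] [_ [/(_ bx)]]].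
  rewrite -/(V r) -/(V r.+1) => leV; rewrite -/C -/(V r) in le1; nia.
have powV k : (C.+1 ^ k * V r0 <= C ^ k * V (r0 + k))%N.
  elim: k => [|k IH]; first by rewrite !expn0 addn0.
  have := stepV (r0 + k)%N; rewrite addnS !expnS => st.
  rewrite -mulnA; apply: leq_trans (leq_mul (leqnn C.+1) IH) _.
  by rewrite mulnCA [(C * _)%N]mulnC -[leqRHS]mulnA leq_mul2l st orbT.
(* For this [k], the lower bound on [V (r0 + k)] exceeds the number of points of the whole box. *)
have [k] := poly_lt_exp_ratio r0 n C_gt0.
apply/negP; rewrite -leqNgt; apply: leq_trans (_ : _ <= C.+1 ^ k * V r0)%N _.
  by rewrite leq_pmulr.
apply: leq_trans (powV k) _; rewrite leq_mul2l; apply/orP; right.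
apply: leq_trans (ncard_sub (finite_box _) (@subIsetr _ _ _)) _.
by rewrite mul2n ncard_box.
Qed.

End Lattice.

Theorem theorem1p12 (R : realType) (n : nat) (M : set 'rV[int]_n)
    (minM : minimal_subgraph M) :
  ~ exists (v : 'rV[R]_n) (a b : R),
      [/\ v != 0, a < b & @lattice_embed R n @` M `<=` closed_slab v a b].
Proof.
move=> [v [a [b [/rV0Pn[i vi0] _ slab]]]].
(* By the Archimedean property, [w] steps along coordinate [i] change [dot v] by more than the width
   [b - a], so they leave the slab from any of its points. *)
pose w := Num.bound ((b - a) / `|v 0 i|).
apply: (minimal_not_thin (i := i) (w := w) minM) => x Mx; exists w => // Mxw.
have /andP[ax xb] : a <= dot v (lattice_embed R x) <= b by apply: slab; exists x.
have : a <= dot v (lattice_embed R (x + delta_mx 0 i *+ w)) <= b.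
  by apply: slab; exists (x + delta_mx 0 i *+ w).
have -> : dot v (lattice_embed R (x + delta_mx 0 i *+ w)) =
          dot v (lattice_embed R x) + v 0 i * w%:R.
  rewrite /dot (bigD1 i)//= [in RHS](bigD1 i)//= !mxE.
  rewrite mulmxnE !mxE !eqxx /= intrD mulrDr.
  rewrite addrAC; congr (_ + _ + _); last by rewrite rmorphMn.
  apply: eq_bigr => j ji.
  by rewrite !mxE mulmxnE mxE (negPf ji) andbF mul0rn addr0.
move=> /andP[axw xwb].
have vi_gt0 : 0 < `|v 0 i| by rewrite normr_gt0.
have ba0 : 0 <= (b - a) / `|v 0 i|.
  by rewrite divr_ge0 ?normr_ge0// subr_ge0; lra.
have := archi_boundP ba0; rewrite -/w ltr_pdivrMr// => lt_w.
have : `|v 0 i * w%:R| <= b - a by rewrite ler_norml; lra.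
by rewrite normrM normr_nat leNgt mulrC lt_w.
Qed.
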